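(* (Complexity of MLMC with levels based on both the number of particles and the number of time steps.) Let $\phi_\infty\in\mathbb{R}$, let $\gamma_{\mathrm p}\ge1$, $s_{\mathrm p}\ge0$, $s_{\mathrm t}>0$. Let $\beta_{\mathrm p},\beta_{\mathrm t}\ge2$ be integers, $P_\ell=\beta_{\mathrm p}^{\ell}$ and $N_\ell=\beta_{\mathrm t}^{\ell}$. Define $$s=\log(\beta_{\mathrm p})+\min(s_{\mathrm p}\log(\beta_{\mathrm p}),\,s_{\mathrm t}\log(\beta_{\mathrm t})),\qquad \gamma=\gamma_{\mathrm p}\log(\beta_{\mathrm p})+\log(\beta_{\mathrm t}),\qquad w=\min(\log(\beta_{\mathrm p}),\log(\beta_{\mathrm t})),$$ and assume $s\le2w$. Suppose that, with constants independent of $N$, $P$ and $\ell$, the particle approximations $\phi_P^N$ and coarse couplings $\varphi_{P_{\ell-1}}^{N_{\ell-1}}$ (described in the context) satisfy $$|\mathrm{E}[\phi_P^N]-\phi_\infty|\lesssim N^{-1}+P^{-1},\qquad \mathrm{Var}[\phi_P^N]\lesssim P^{-1},$$ $$\mathrm{Var}\big[\phi_{P_\ell}^{N_\ell}-\varphi_{P_{\ell-1}}^{N_{\ell-1}}\big]\lesssim \beta_{\mathrm p}^{-\ell}\big(\max(\beta_{\mathrm p}^{-s_{\mathrm p}},\beta_{\mathrm t}^{-s_{\mathrm t}})\big)^{\ell},$$ and that the work of generating one sample of $\phi_{P_\ell}^{N_\ell}-\varphi_{P_{\ell-1}}^{N_{\ell-1}}$ is $\lesssim N_\ell P_\ell^{\gamma_{\mathrm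 p}}$. For fixed $0<\epsilon<1$ and any $0<\mathrm{TOL}<e^{-1}$, there exist $L$ and numbers of samples $\{M_\ell\}_{\ell=0}^L$ such that the estimator $$\mathcal{A}_{\mathrm{MLMC}}=\sum_{\ell=0}^L\frac1{M_\ell}\sum_{m=1}^{M_\ell}\big(\phi_{P_\ell}^{N_\ell}-\varphi_{P_{\ell-1}}^{N_{\ell-1}}\big)\big(\boldsymbol\omega_{1:P_\ell}^{(\ell,m)}\big)$$ satisfies $\mathrm{P}[|\mathcal{A}_{\mathrm{MLMC}}-\phi_\infty|\ge\mathrm{TOL}]\le\epsilon$ and $$\mathrm{Work}[\mathcal{A}_{\mathrm{MLMC}}]\lesssim\begin{cases}\mathrm{TOL}^{-2}&\text{if } s>\gamma,\\ \mathrm{TOL}^{-2}(\log(\mathrm{TOL}^{-1}))^2&\text{if } s=\gamma,\\ \mathrm{TOL}^{-2-\frac{\gamma-s}{w}}&\text{if } s<\gamma.\end{cases}$$ In particular, for $\beta_{\mathrm p}=\beta_{\mathrm t}$, $\gamma_{\mathrm p}=2$, $s_{\mathrm p}=1$ and $s_{\mathrm t}=2$ the work is $\lesssim\mathrm{TOL}^{-3}$.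
   Context: $a\lesssim b$ means $a<cb$ for a constant $c$; in the conclusion $c$ is independent of $\mathrm{TOL}$ (it may depend on $\epsilon$). For positive integers $P,N$, $\phi_P^N=\frac1P\sum_{p=1}^P\psi(X_{p|P}^{N|N})$ is the average of a quantity of interest $\psi$ over $P$ exchangeable particles at final time $T$, where the particles follow a system of coupled SDEs in which particle $p$ is driven by its Wiener process $W_p$ and interacts with the others through the empirical measure of the system, approximated by a time-stepping scheme with $N$ uniform steps. $\phi_\infty=\mathrm{E}[\psi(X_\infty(T))]$ is the corresponding mean-field value ($X_\infty$ solves the limiting McKean-Vlasov SDE). $\boldsymbol\omega_{1:P}$ denotes the collection of underlying random inputs of the $P$ particles (Wiener paths, initial values, random coefficients), i.i.d. over particles, $\boldsymbol\omega_{p:q}$ the inputs of particles $p,\dots,q$, and $\boldsymbol\omega_{1:P_\ell}^{(\ell,m)}$ are samples, mutually independent over $(\ell,m)$; $\phi_P^N$ is a function of the inputs of $P$ particles. The coarse coupling $\varphi_{P_{\ell-1}}^{N_{\ell-1}}$ is a function of $\boldsymbol\omega_{1:P_\ell}$ with $\varphi_{P_{-1}}^{N_{-1}}=0$ and $\mathrm{E}[\varphi_{P_{\ell-1}}^{N_{\ell-1}}]=\mathrm{E}[\phi_{P_{\ell-1}}^{N_{\ell-1}}]$ for $\ell\ge1$; the two choices considered are, with $N=N_{\ell-1}$, $\varphi_{P_{\ell-1}}^{N}(\boldsymbol\omega_{1:P_\ell})=\phi_{P_{\ell-1}}^{N}(\boldsymbol\omega_{1:P_{\ell-1}})$ and the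 partitioning sampler $\varphi_{P_{\ell-1}}^{N}(\boldsymbol\omega_{1:P_\ell})=\frac1{\beta_{\mathrm p}}\sum_{i=1}^{\beta_{\mathrm p}}\phi_{P_{\ell-1}}^{N}(\boldsymbol\omega_{(i-1)P_{\ell-1}+1\,:\,iP_{\ell-1}})$. $\mathrm{Work}[\mathcal{A}_{\mathrm{MLMC}}]$ is the sum over $\ell$ of $M_\ell$ times the work of one sample of the level-$\ell$ difference. The numbers of samples are positive integers. *)

(* Defs.v *)
From HB Require Import structures.
From mathcomp Require Import all_boot all_order all_algebra.
From mathcomp Require Import perm.
From mathcomp Require Import all_classical all_reals all_analysis.

Set Implicit Arguments.
Unset Strict Implicit.
Unset Printing Implicit Defensive.

Import Order.TTheory GRing.Theory Num.Theory.
Import numFieldNormedType.Exports.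

Local Open Scope classical_set_scope.
Local Open Scope ring_scope.

(* Mutual independence of a family of random variables: product rule over all
   finite subfamilies. The target spaces may vary with the index. *)
Definition mutually_independent (d d' : measure_display)
    (Omega : measurableType d) (R : realType) (Pr : probability Omega R)
    (I : eqType) (T : I -> measurableType d') (X : forall i, Omega -> T i) :=
  forall (s : seq I) (A : forall i, set (T i)),
    uniq s -> (forall i, measurable (A i)) ->
    Pr (\bigcap_(i in [set` s]) X i @^-1` A i) =
    (\prod_(i <- s) Pr (X i @^-1` A i))%E.

Definition same_distribution (d d' : measure_display)
    (Omega : measurableType d) (R : realType) (Pr : probability Omega R)
    (T : measurableType d') (X Y : Omega -> T) :=
  forall A : set T, measurable A -> Pr (X @^-1` A) = Pr (Y @^-1` A).

Definition exchangeable (d d' : measure_display)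
    (Omega : measurableType d) (R : realType) (Pr : probability Omega R)
    (T : measurableType d') (P : nat) (X : Omega -> P.-tuple T) :=
  forall sg : {perm 'I_P},
    same_distribution Pr X (fun x => [tuple tnth (X x) (sg p) | p < P]).

(* The inputs omega_{1:P}; particles are numbered from 0. *)
Definition inputs (Omega E : Type) (om : nat -> Omega -> E) (P : nat)
    (x : Omega) : P.-tuple E :=
  [tuple om p x | p < P].

(* phi_P^N as a function of the inputs of P particles. X P N n maps these
   inputs to the P particle states after n of the N time steps. *)
Definition particle_average (R : realType) (E S : Type) (psi : S -> R)
    (X : forall P N n : nat, P.-tuple E -> P.-tuple S) (P N : nat)
    (w : P.-tuple E) : R :=
  P%:R^-1 * \sum_(p < P) psi (tnth (X P N N w) p).

(* phi_{P_l}^{N_l} - varphi_{P_{l-1}}^{N_{l-1}} with P_l = bp ^ l and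
   N_l = bt ^ l. The coarse term of this difference is varphi l, so that
   varphi 0 stands for varphi_{P_{-1}}^{N_{-1}}. *)
Definition level_difference (R : realType) (E : Type) (bp bt : nat)
    (phi : forall P N : nat, P.-tuple E -> R)
    (varphi : forall l : nat, (bp ^ l)%N.-tuple E -> R)
    (l : nat) (w : (bp ^ l)%N.-tuple E) : R :=
  phi (bp ^ l)%N (bt ^ l)%N w - varphi l w.

(* W (l, m) is the m-th sample of the inputs at level l. *)
Definition mlmc_estimator (R : realType) (Omega E : Type) (bp : nat)
    (D : forall l : nat, (bp ^ l)%N.-tuple E -> R)
    (W : forall i : nat * nat, Omega -> (bp ^ i.1)%N.-tuple E)
    (L : nat) (M : nat -> nat) (x : Omega) : R :=
  \sum_(l < L.+1)
    ((M l)%:R^-1 * \sum_(m < M l) D l (W (nat_of_ord l, nat_of_ord m) x)).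

Definition mlmc_work (R : realType) (work : nat -> R) (L : nat)
    (M : nat -> nat) : R :=
  \sum_(l < L.+1) (M l)%:R * work l.

Definition exponent_s (R : realType) (bp bt : nat) (sp st : R) : R :=
  ln bp%:R + Num.min (sp * ln bp%:R) (st * ln bt%:R).

Definition exponent_gamma (R : realType) (bp bt : nat) (gp : R) : R :=
  gp * ln bp%:R + ln bt%:R.

Definition exponent_w (R : realType) (bp bt : nat) : R :=
  Num.min (ln bp%:R) (ln bt%:R).

Definition mlmc_rate (R : realType) (s gamma w TOL : R) : R :=
  if gamma < s then TOL ^- 2
  else if s == gamma then TOL ^- 2 * ln TOL^-1 ^+ 2
  else TOL `^ (- 2 - (gamma - s) / w).

(* Main.v *)
Require Import Defs.
From HB Require Import structures.
From mathcomp Require Import all_boot all_order all_algebra.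
From mathcomp Require Import perm.
From mathcomp Require Import all_classical all_reals all_analysis.
From mathcomp Require Import measurable_realfun ring lra.

(** The mean of the estimator telescopes to the mean of the particle
approximation on the finest level, so that its bias is a multiple of
[exp (- w L)] ([level_bias_le]).  Its variance is the sum of the variances of
the level differences divided by the numbers of samples, because independent
square integrable samples are uncorrelated ([covariance_independent],
[mlmc_estimator_variance]).  If the bias is at most [TOL / 2] and the variance
at most [eps (TOL / 2)^2], Chebyshev's inequality gives the required bound on
the probability of failure ([chebyshev_bias]).

What remains is a deterministic optimisation ([mlmc_parameters]).  In terms of
[s], [gamma] and [w], level [l] has variance [exp (- s l)] and cost
[exp (gamma l)] up to constants.  The bias fixes [L] at [ln TOL^-1 / w] up to a
constant, and a Lagrange multiplier argument makes [M_l] proportional to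
[TOL^-2 exp (- (s + gamma) l / 2) S], where [S] is the sum over [l <= L] of
[exp ((gamma - s) l / 2)].  The work is then at most a multiple of [TOL^-2 S^2]
plus a multiple of the sum of [exp (gamma l)], which accounts for rounding
every [M_l] up to a positive integer.  The geometric sum [S] is bounded, equal to [L + 1], or
dominated by its last term according to the sign of [gamma - s], and these are
the three regimes of the rate ([sqr_sum_expR_rate]).  The rounding term is of
order [TOL^-(gamma / w)], which [s <= 2 w] keeps below the rate in every regime
([sum_expR_work_rate]). *)

Set Implicit Arguments.
Unset Strict Implicit.
Unset Printing Implicit Defensive.

Import Order.TTheory GRing.Theory Num.Theory.
Import numFieldNormedType.Exports.

Local Open Scope classical_set_scope.
Local Open Scope ring_scope.

(** * Variance, transfer of laws and independence *)

(** A finite variance makes the centred variable square integrable, and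
constants are square integrable under a probability. *)
Lemma Lfun2_of_variance (d : measure_display) (T : measurableType d)
    (R : realType) (P : probability T R) (X : T -> R) :
  measurable_fun setT X -> ('V_P[X] < +oo)%E -> X \in Lfun P 2%:E.
Proof.
move=> mX; pose c := fine 'E_P[X]; pose Y := X \- cst c.
have mY : measurable_fun setT Y by exact: measurable_funB.
rewrite /variance unlock -/c -/Y unlock => VX.
suff Y2 : Y \in Lfun P 2%:E.
  have -> : X = Y \+ cst c by apply/funext => x; rewrite /Y /= subrK.
  by rewrite rpredD ?lee1n//= => _; rewrite Lfun_cst.
rewrite inE; apply/andP; split; rewrite inE//=.
rewrite /finite_norm unlock poweR_lty//.
under eq_integral => x _ do rewrite /= powR_mulrn// real_normK ?num_real//.
exact: VX.
Qed.

Section transfer.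
Context (d d' : measure_display) (Omega : measurableType d)
  (T : measurableType d') (R : realType) (Pr : probability Omega R).
Variables X Y : Omega -> T.
Hypotheses (mX : measurable_fun setT X) (mY : measurable_fun setT Y).
Hypothesis XY : same_distribution Pr X Y.

Lemma ge0_integral_same_distribution (f : T -> \bar R) :
  measurable_fun setT f -> (forall t, 0 <= f t)%E ->
  (\int[Pr]_x (f \o X) x = \int[Pr]_x (f \o Y) x)%E.
Proof.
move=> mf f0.
pose X' : {mfun Omega >-> T} := HB.pack X (isMeasurableFun.Build _ _ _ _ _ mX).
pose Y' : {mfun Omega >-> T} := HB.pack Y (isMeasurableFun.Build _ _ _ _ _ mY).
rewrite -(@ge0_integral_distribution _ _ _ _ _ _ X' f)//.
rewrite -(@ge0_integral_distribution _ _ _ _ _ _ Y' f)//.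
by apply: eq_measure_integral => A mA _; exact: XY.
Qed.

(** The integral is by definition the difference of the integrals of the
positive and negative parts, and each of the two is transferred separately. *)
Lemma expectation_same_distribution (f : T -> R) : measurable_fun setT f ->
  ('E_Pr[f \o X] = 'E_Pr[f \o Y])%E.
Proof.
move=> mf; have mf' : measurable_fun setT (EFin \o f) by exact/measurable_EFinP.
have split_EZ (Z : Omega -> T) : ('E_Pr[f \o Z] =
    \int[Pr]_x (((EFin \o f)^\+)%E \o Z) x -
    \int[Pr]_x (((EFin \o f)^\-)%E \o Z) x)%E.
  rewrite unlock -(funepos_comp (EFin \o f) Z) -(funeneg_comp (EFin \o f) Z).
  exact: integralE.
rewrite !split_EZ; congr (_ - _)%E.
- apply: (@ge0_integral_same_distribution ((EFin \o f)^\+)%E) => //.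
  exact: measurable_funepos.
- apply: (@ge0_integral_same_distribution ((EFin \o f)^\-)%E) => //.
  exact: measurable_funeneg.
Qed.

Lemma variance_same_distribution (f : T -> R) : measurable_fun setT f ->
  ('V_Pr[f \o X] = 'V_Pr[f \o Y])%E.
Proof.
move=> mf; rewrite /variance unlock expectation_same_distribution//.
set c := fine _.
apply: (@expectation_same_distribution (fun t => (f t - c) * (f t - c))).
by apply: measurable_funM; apply: measurable_funB.
Qed.

End transfer.

(** The product rule for the pair [i], [j] needs a measurable set for every
index; the family below is [A] at [i], [B] at [j] and everything elsewhere,
transported along the equality of indices since the target types depend on
them. *)
Lemma mutually_independent2 (d d' : measure_display)
    (Omega : measurableType d) (R : realType) (Pr : probability Omega R)
    (I : eqType) (T : I -> measurableType d') (X : forall i, Omega -> T i)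
    (i j : I) (A : set (T i)) (B : set (T j)) :
  mutually_independent Pr X -> i != j -> measurable A -> measurable B ->
  Pr (X i @^-1` A `&` X j @^-1` B) = (Pr (X i @^-1` A) * Pr (X j @^-1` B))%E.
Proof.
move=> indX ij mA mB.
pose U k : set (T k) :=
  match i =P k with
  | ReflectT e => ecast k (set (T k)) e A
  | ReflectF _ => match j =P k with
     | ReflectT e => ecast k (set (T k)) e B
     | ReflectF _ => setT
     end
  end.
have Ui : U i = A.
  by rewrite /U; case: eqP => // e; rewrite (eq_axiomK e).
have Uj : U j = B.
  rewrite /U; case: eqP => [e|_]; first by rewrite e eqxx in ij.
  by case: eqP => // e; rewrite (eq_axiomK e).
have mU k : measurable (U k).
  rewrite /U; case: eqP => [e|_]; first by case: _ / e.
  by case: eqP => [e|_] //; case: _ / e.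
have := indX [:: i; j] U; rewrite /= inE ij => /(_ isT mU).
rewrite !big_cons big_nil mule1 Ui Uj => <-; congr (Pr _).
apply/seteqP; split => [x [Ax Bx] k /=|x h].
  by rewrite !inE => /orP[]/eqP->; rewrite /preimage /= ?Ui ?Uj.
split.
  by have := h i; rewrite /= inE eqxx /= /preimage /= Ui; exact.
by have := h j; rewrite /= !inE eqxx orbT /= /preimage /= Uj; exact.
Qed.

(** The product rule says that the joint law agrees on rectangles with the
product of the two laws, hence everywhere; Fubini's theorem then factors the
integral of [x * y]. *)
Lemma covariance_independent (d : measure_display)
    (Omega : measurableType d) (R : realType) (Pr : probability Omega R)
    (X Y : Omega -> R) :
  X \in Lfun Pr 2%:E -> Y \in Lfun Pr 2%:E ->
  (forall A B : set R, measurable A -> measurable B ->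
    Pr (X @^-1` A `&` Y @^-1` B) = (Pr (X @^-1` A) * Pr (Y @^-1` B))%E) ->
  covariance Pr X Y = 0%E.
Proof.
move=> X2 Y2 indXY.
have Pfin : Pr setT \is a fin_num := fin_num_measure Pr _ measurableT.
have X1 := Lfun_subset12 Pfin X2.
have Y1 := Lfun_subset12 Pfin Y2.
have XY1 := Lfun2_mul_Lfun1 X2 Y2.
have /andP[/[!inE]/= mX _] := X2.
have /andP[/[!inE]/= mY _] := Y2.
rewrite covarianceE//.
pose X' : {mfun Omega >-> R} := HB.pack X (isMeasurableFun.Build _ _ _ _ _ mX).
pose Y' : {mfun Omega >-> R} := HB.pack Y (isMeasurableFun.Build _ _ _ _ _ mY).
have mXY : measurable_fun setT (fun x => (X x, Y x)).
  exact: measurable_fun_pair.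
pose XY : {mfun Omega >-> (R * R)%type} :=
  HB.pack (fun x => (X x, Y x)) (isMeasurableFun.Build _ _ _ _ _ mXY).
pose f (z : R * R) : \bar R := (z.1 * z.2)%:E.
have mf : measurable_fun setT f.
  apply/measurable_EFinP; exact: measurable_funM.
have joint A : measurable A ->
    (distribution Pr X' \x distribution Pr Y')%E A = distribution Pr XY A.
  apply: product_measure_unique => B C mB mC.
  exact: indXY.
have intf : (distribution Pr XY).-integrable setT f.
  apply: (@integrable_pushforward _ _ _ _ _ _ mXY Pr setT f) => //.
  exact/Lfun1_integrable.
have intf' : (distribution Pr X' \x distribution Pr Y')%E.-integrable setT f.
  apply/integrableP; split => //.
  move/integrableP : intf => [_]; apply: le_lt_trans.
  rewrite (eq_measure_integral (distribution Pr XY))// => A mA _; exact: joint.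
have -> : ('E_Pr[X * Y] = \int[distribution Pr XY]_z f z)%E.
  rewrite (@integral_distribution _ _ _ _ _ _ XY f)//; first by rewrite unlock.
  exact/Lfun1_integrable.
rewrite -(eq_measure_integral _ (fun A mA _ => joint A mA)).
rewrite -integral12_prod_meas1//.
have EY : (\int[distribution Pr Y']_y y%:E = 'E_Pr[Y])%E.
  rewrite (@integral_distribution _ _ _ _ _ _ Y' EFin)//.
    by rewrite unlock.
  exact/Lfun1_integrable.
have EX : (\int[distribution Pr X']_y y%:E = 'E_Pr[X])%E.
  rewrite (@integral_distribution _ _ _ _ _ _ X' EFin)//.
    by rewrite unlock.
  exact/Lfun1_integrable.
have iY : (distribution Pr Y').-integrable setT EFin.
  apply: (@integrable_pushforward _ _ _ _ _ _ mY Pr setT EFin) => //.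
  exact/Lfun1_integrable.
have iX : (distribution Pr X').-integrable setT EFin.
  apply: (@integrable_pushforward _ _ _ _ _ _ mX Pr setT EFin) => //.
  exact/Lfun1_integrable.
rewrite /fubini_F /f /=.
under eq_integral => x _.
  under eq_integral => y _ do rewrite EFinM.
  rewrite integralZl// EY -[Z in (_ * Z)%E]fineK ?expectation_fin_num//.
  over.
rewrite integralZr// EX fineK ?expectation_fin_num// subee//.
by rewrite fin_numM ?expectation_fin_num.
Qed.

Lemma variance_sum_uncorrelated (d : measure_display)
    (Omega : measurableType d) (R : realType) (Pr : probability Omega R)
    (I : eqType) (Y : I -> Omega -> R) (r : seq I) :
  uniq r -> (forall i, i \in r -> Y i \in Lfun Pr 2%:E) ->
  (forall i j, i != j -> covariance Pr (Y i) (Y j) = 0%E) ->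
  (\sum_(i <- r) Y i)%R \in Lfun Pr 2%:E /\
  ('V_Pr[(\sum_(i <- r) Y i)%R] = \sum_(i <- r) 'V_Pr[Y i])%E.
Proof.
move=> + + cov0; have l2 := @lee1n R 2.
(* The induction also needs that a variable outside the list is uncorrelated
   with the sum. *)
suff H : uniq r -> (forall i, i \in r -> Y i \in Lfun Pr 2%:E) ->
  [/\ (\sum_(i <- r) Y i)%R \in Lfun Pr 2%:E,
  ('V_Pr[(\sum_(i <- r) Y i)%R] = \sum_(i <- r) 'V_Pr[Y i])%E &
  forall j, j \notin r -> Y j \in Lfun Pr 2%:E ->
    covariance Pr (Y j) (\sum_(i <- r) Y i)%R = 0%E].
  by move=> u h; have [] := H u h.
elim: r => [_ _|i r IH /= /andP[ir ur] Yr].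
  rewrite !big_nil; split; first by rewrite rpred0.
    exact: (variance_cst Pr 0).
  by move=> j _ _; exact: (covariance_cst_r Pr _ 0).
have [k kr|S2 VS covS] := IH ur; first by rewrite Yr// inE kr orbT.
have Yi : Y i \in Lfun Pr 2%:E by rewrite Yr// mem_head.
rewrite !big_cons; split.
- exact: rpredD.
- by rewrite varianceD// VS covS// mule0 adde0.
- move=> j; rewrite inE negb_or => /andP[ji jr] Yj.
  by rewrite covarianceDr// cov0// covS// adde0.
Qed.

(** * Geometric sums and the complexity rate *)

Lemma sum_expR_neg (R : realType) (q : R) (L : nat) : q < 0 ->
  \sum_(l < L) expR (q * l%:R) <= (1 - expR q)^-1.
Proof.
move=> q0; have x1 : expR q < 1 by rewrite expR_lt1.
have d0 : 0 < 1 - expR q by rewrite subr_gt0.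
under eq_bigr do rewrite expRM_natr.
rewrite -[leRHS]mul1r ler_pdivlMr// mulrC.
rewrite -[X in X * _]opprB mulNr -subrX1 opprB.
by rewrite gerBl exprn_ge0// expR_ge0.
Qed.

(** Read from the last term backwards, an increasing geometric sum is its last
term times a decreasing one. *)
Lemma sum_expR_pos (R : realType) (q : R) (L : nat) : 0 < q ->
  \sum_(l < L.+1) expR (q * l%:R) <= (1 - expR (- q))^-1 * expR (q * L%:R).
Proof.
move=> q0; have nq0 : - q < 0 by rewrite oppr_lt0.
rewrite (reindex_inj rev_ord_inj)/=.
rewrite (eq_bigr (fun l : 'I_L.+1 =>
    expR (- q * l%:R) * expR (q * L%:R))); last first.
  move=> l _; rewrite subSS natrB -1?ltnS// -expRD; congr expR; ring.
rewrite -mulr_suml ler_wpM2r ?expR_ge0//; exact: sum_expR_neg.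
Qed.

Lemma expRN_exp2V (R : realType) (T : R) : expR (- T) ^- 2 = expR (2 * T).
Proof. by rewrite -exprVn -expRN opprK -expRM_natl. Qed.

(** The tolerance is written [exp (- T)] from here on, so that [T] is
the logarithm in the rate and [TOL <= exp (- 1)] reads [1 <= T]. *)
Lemma mlmc_rate_gt (R : realType) (s gamma w T : R) : gamma < s ->
  mlmc_rate s gamma w (expR (- T)) = expR (2 * T).
Proof. by move=> gs; rewrite /mlmc_rate gs expRN_exp2V. Qed.

Lemma mlmc_rate_eq (R : realType) (s w T : R) :
  mlmc_rate s s w (expR (- T)) = expR (2 * T) * T ^+ 2.
Proof. by rewrite /mlmc_rate ltxx eqxx expRN_exp2V -expRN opprK expRK. Qed.

Lemma mlmc_rate_lt (R : realType) (s gamma w T : R) : s < gamma ->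
  mlmc_rate s gamma w (expR (- T))
  = expR (2 * T) * expR ((gamma - s) / w * T).
Proof.
move=> sg; rewrite /mlmc_rate ltNge (ltW sg) lt_eqF//= -expRM -expRD.
by congr expR; ring.
Qed.

(** The three regimes of the rate are those of a geometric sum of ratio
[exp ((gamma - s) / 2)]: bounded, equal to the number of its terms, or
dominated by its last term.  The hypothesis on [L] says that the finest level
is not much finer than the bias requires. *)
Lemma sqr_sum_expR_rate (R : realType) (s gamma w k : R) : 0 < w ->
  exists2 K : R, 0 < K & forall (T : R) (L : nat), 1 <= T ->
    w * L%:R <= T + k ->
    expR (2 * T) * (\sum_(l < L.+1) expR ((gamma - s) / 2 * l%:R)) ^+ 2
      <= K * mlmc_rate s gamma w (expR (- T)).
Proof.
move=> w0.
have sum_ge0 (q : R) L : 0 <= \sum_(l < L) expR (q * l%:R).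
  by apply: sumr_ge0 => l _; exact: expR_ge0.
have [gs|sg|->] := ltgtP gamma s.
- have q0 : (gamma - s) / 2 < 0 by lra.
  have d0 : 0 < (1 - expR ((gamma - s) / 2))^-1.
    by rewrite invr_gt0 subr_gt0 expR_lt1.
  exists ((1 - expR ((gamma - s) / 2))^-1 ^+ 2); first exact: exprn_gt0.
  move=> T L T1 _; rewrite mlmc_rate_gt// mulrC ler_wpM2r ?expR_ge0//.
  by rewrite lerXn2r ?nnegrE// ?(ltW d0)//; exact: sum_expR_neg.
- have q0 : 0 < (gamma - s) / 2 by lra.
  have d0 : 0 < (1 - expR (- ((gamma - s) / 2)))^-1.
    by rewrite invr_gt0 subr_gt0 expR_lt1; lra.
  set d := _^-1 in d0 *.
  exists (d ^+ 2 * expR ((gamma - s) / w * k)).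
    by rewrite mulr_gt0 ?exprn_gt0 ?expR_gt0.
  move=> T L T1 wL.
  rewrite mlmc_rate_lt// [leRHS]mulrCA ler_wpM2l ?expR_ge0//.
  rewrite -[leRHS]mulrA -expRD -mulrDr.
  apply: (@le_trans _ _ ((d * expR ((gamma - s) / 2 * L%:R)) ^+ 2)).
    rewrite lerXn2r ?nnegrE//; last exact: sum_expR_pos.
    by rewrite mulr_ge0 ?expR_ge0// ltW.
  rewrite exprMn ler_wpM2l ?exprn_ge0 ?(ltW d0)// -expRM_natl ler_expR.
  rewrite [leLHS](_ : _ = (gamma - s) / w * (w * L%:R)).
    by rewrite ler_wpM2l ?(addrC k)// divr_ge0 ?(ltW w0)// subr_ge0 ltW.
  by field; rewrite gt_eqF.
- exists ((`|k| + w + 1) ^+ 2 / w ^+ 2).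
    rewrite divr_gt0 ?exprn_gt0//.
    by have := normr_ge0 k; lra.
  move=> T L T1 wL; rewrite mlmc_rate_eq [leRHS]mulrCA ler_wpM2l ?expR_ge0//.
  rewrite subrr mul0r; under eq_bigr do rewrite mul0r expR0.
  rewrite sumr_const card_ord -expr_div_n -exprMn lerXn2r ?nnegrE//.
    rewrite mulr_ge0 ?divr_ge0 ?(ltW w0)//; last by lra.
    by have := normr_ge0 k; lra.
  rewrite mulrAC ler_pdivlMr// -natr1 mulrDl mul1r mulrC.
  have k0 := normr_ge0 k; have kk := ler_norm k.
  have kT : `|k| <= `|k| * T by rewrite ler_peMr.
  have wT : w <= w * T by rewrite ler_peMr// ltW.
  lra.
Qed.

(** One sample on every level costs at most a multiple of [exp (gamma / w * T)].
Since [gamma / w = (gamma - s) / w + s / w] with [s / w <= 2], this is within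
the rate in every regime. *)
Lemma sum_expR_work_rate (R : realType) (s gamma w k : R) :
  0 < w -> 0 < gamma -> s <= 2 * w ->
  exists2 K : R, 0 < K & forall (T : R) (L : nat), 1 <= T ->
    w * L%:R <= T + k ->
    \sum_(l < L.+1) expR (gamma * l%:R)
      <= K * mlmc_rate s gamma w (expR (- T)).
Proof.
move=> w0 g0 sw.
have d0 : 0 < (1 - expR (- gamma))^-1.
  by rewrite invr_gt0 subr_gt0 expR_lt1; lra.
set d := _^-1 in d0 *.
exists (d * expR (gamma / w * k)); first by rewrite mulr_gt0 ?expR_gt0.
move=> T L T1 wL; apply: le_trans (sum_expR_pos _ g0) _.
rewrite -/d -[leRHS]mulrA ler_wpM2l ?(ltW d0)//.
apply: (@le_trans _ _ (expR (gamma / w * k) * expR (gamma / w * T))).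
  rewrite -expRD ler_expR -mulrDr -mulrA ler_wpM2l ?(ltW g0)//.
  by rewrite mulrC ler_pdivlMr// mulrC addrC.
rewrite ler_wpM2l ?expR_ge0//.
have e2 : s / w <= 2 by rewrite ler_pdivrMr.
have gwE : gamma / w = (gamma - s) / w + s / w by ring.
have T0 : 0 <= T by lra.
have [gs|sg|sg] := ltgtP gamma s.
- rewrite mlmc_rate_gt// ler_expR ler_wpM2r// (le_trans _ e2)//.
  by rewrite ler_pM2r ?invr_gt0// ltW.
- rewrite mlmc_rate_lt// -expRD ler_expR -mulrDl ler_wpM2r//.
  by rewrite gwE addrC lerD2r.
- rewrite sg mlmc_rate_eq; apply: (@le_trans _ _ (expR (2 * T) * 1)).
    by rewrite mulr1 ler_expR ler_wpM2r// -sg.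
  by rewrite ler_wpM2l ?expR_ge0// exprn_ege1.
Qed.

(** * Choice of the levels and of the numbers of samples *)

(** The numbers of samples minimise the work for a given variance: [M_l] is
proportional to the square root of variance over cost.  The two bounds on the
accuracy fix [L] and the factor of proportionality. *)
Lemma mlmc_parameters (R : realType) (C s gamma w eps : R) :
  1 <= C -> 0 < w -> 0 < gamma -> s <= 2 * w -> 0 < eps ->
  exists c : R, forall TOL : R, 0 < TOL < expR (- 1) ->
  exists (L : nat) (M : nat -> nat),
    [/\ (forall l, (0 < M l)%N),
        2 * C * expR (- (w * L%:R)) <= TOL / 2,
        \sum_(l < L.+1) (M l)%:R^-1 * (C * expR (- (s * l%:R)))
          <= eps * (TOL / 2) ^+ 2 &
        \sum_(l < L.+1) (M l)%:R * (C * expR (gamma * l%:R))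
          < c * mlmc_rate s gamma w TOL].
Proof.
move=> C1 w0 g0 sw eps0.
have C0 : 0 < C by lra.
pose k := ln (4 * C) + w.
have [K1 K10 HK1] := sqr_sum_expR_rate s gamma k w0.
have [K2 K20 HK2] := sum_expR_work_rate k w0 g0 sw.
exists (C * K2 + C * (4 * C / eps) * K1 + 1) => TOL /andP[TOL0 TOL1].
pose T := - ln TOL.
have TOLE : TOL = expR (- T) by rewrite /T opprK lnK.
have T1 : 1 <= T.
  by rewrite ltW// -ltrN2 -ltr_expR -TOLE.
have C4 : 0 <= ln (4 * C) by rewrite ln_ge0//; lra.
pose y := (T + ln (4 * C)) / w.
have y0 : 0 <= y by rewrite divr_ge0 ?(ltW w0)//; lra.
(* The bias condition [2 C exp (- w l) <= TOL / 2] amounts to [y <= l]. *)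
pose L := (Num.truncn y).+1.
have wL : w * L%:R <= T + k.
  have : (Num.truncn y)%:R <= y by rewrite truncn_le.
  by rewrite ler_pdivlMr// -[L%:R]natr1 /k; lra.
have Lw : T + ln (4 * C) <= w * L%:R.
  by rewrite [leRHS]mulrC -ler_pdivrMr// ltW// truncnS_gt.
pose q := (gamma - s) / 2.
pose S := \sum_(l < L.+1) expR (q * l%:R).
have S0 : 0 < S.
  rewrite /S big_ord_recl ltr_pwDl ?expR_gt0//.
  by apply: sumr_ge0 => l _; exact: expR_ge0.
(* The real-valued optimal numbers of samples, normalised so that the variance
   is [eps (TOL / 2)^2] exactly. *)
pose x l : R :=
  4 * C / eps * expR (2 * T) * S * expR (- ((s + gamma) / 2 * l%:R)).
have x0 l : 0 < x l.
  by rewrite /x !mulr_gt0 ?invr_gt0 ?expR_gt0//.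
pose M l := (Num.truncn (x l)).+1.
have xM l : x l <= (M l)%:R by rewrite ltW// truncnS_gt.
have Mx l : (M l)%:R <= x l + 1.
  by rewrite -[(M l)%:R]natr1 lerD2r truncn_le ltW.
have u1 : expR (- T) ^+ 2 * expR (2 * T) = 1.
  by rewrite -expRM_natl -expRD -mulrDr addNr mulr0 expR0.
have u2 l : expR (s * l%:R) * expR (q * l%:R)
    * expR (- ((s + gamma) / 2 * l%:R)) = 1.
  by rewrite -!expRD -[RHS]expR0; congr expR; rewrite /q; field.
exists L, M; split => //.
- have e1 : expR (- (w * L%:R)) <= TOL * (4 * C)^-1.
    rewrite TOLE -[X in _ * X^-1]lnK ?posrE; last by lra.
    by rewrite -expRN -expRD ler_expR; lra.
  have C2 : 0 <= 2 * C by lra.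
  apply: le_trans (ler_wpM2l C2 e1) _.
  by rewrite [leLHS](_ : _ = TOL / 2)//; field; lra.
- (* Level [l] contributes its share [exp (q l) / S] of the total variance. *)
  have h (l : 'I_L.+1) : (M l)%:R^-1 * (C * expR (- (s * l%:R)))
     <= eps * (TOL / 2) ^+ 2 / S * expR (q * l%:R).
    rewrite mulrC ler_pdivrMr; last by rewrite ltr0n.
    have r0 : 0 <= eps * (TOL / 2) ^+ 2 / S * expR (q * l%:R).
      by rewrite !mulr_ge0 ?invr_ge0 ?expR_ge0 ?exprn_ge0 ?ltW//.
    apply: le_trans (ler_wpM2l r0 (xM l)).
    rewrite /x TOLE -(@ler_pM2l _ (expR (s * l%:R))) ?expR_gt0//.
    rewrite mulrCA -expRD addrN expR0 mulr1.
    rewrite [leRHS](_ : _ = C * (expR (- T) ^+ 2 * expR (2 * T)) *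
      (expR (s * l%:R) * expR (q * l%:R) * expR (- ((s + gamma) / 2 * l%:R)))).
      by rewrite u1 u2 !mulr1.
    by field; rewrite !gt_eqF.
  apply: le_trans (ler_sum _ (fun l _ => h l)) _.
  by rewrite -mulr_sumr -/S mulfVK// gt_eqF.
- apply: (@le_lt_trans _ _ (C * \sum_(l < L.+1) expR (gamma * l%:R) +
     C * (4 * C / eps) * (expR (2 * T) * S ^+ 2))).
    (* The first term is the cost of rounding, from [M l <= x l + 1]. *)
    have h (l : 'I_L.+1) : (M l)%:R * (C * expR (gamma * l%:R)) <=
       C * expR (gamma * l%:R)
       + C * (4 * C / eps) * (expR (2 * T) * S) * expR (q * l%:R).
      have r0 : 0 <= C * expR (gamma * l%:R) by rewrite mulr_ge0 ?expR_ge0 ?ltW.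
      apply: le_trans (ler_wpM2r r0 (Mx l)) _.
      rewrite mulrDl mul1r addrC lerD2l /x.
      rewrite [expR (q * _)](_ : _ =
        expR (- ((s + gamma) / 2 * l%:R)) * expR (gamma * l%:R)).
        by rewrite le_eqVlt; apply/orP; left; apply/eqP; ring.
      by rewrite -expRD; congr expR; rewrite /q; field.
    apply: le_trans (ler_sum _ (fun l _ => h l)) _.
    rewrite big_split/= -!mulr_sumr -/S.
    by rewrite le_eqVlt; apply/orP; left; apply/eqP; ring.
  have rate0 : 0 < mlmc_rate s gamma w TOL.
    rewrite TOLE; have [gs|sg|->] := ltgtP gamma s.
    - by rewrite mlmc_rate_gt ?expR_gt0.
    - by rewrite mlmc_rate_lt// mulr_gt0 ?expR_gt0.
    - by rewrite mlmc_rate_eq mulr_gt0 ?expR_gt0 ?exprn_gt0//; lra.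
  have h1 := HK1 T L T1 wL; have h2 := HK2 T L T1 wL.
  rewrite -TOLE -/q -/S in h1 h2.
  have CC : 0 <= C * (4 * C / eps) by rewrite !mulr_ge0 ?invr_ge0 ?ltW.
  have := ler_wpM2l (ltW C0) h2; have := ler_wpM2l CC h1.
  set rate := mlmc_rate _ _ _ _ in rate0 *.
  rewrite !mulrDl !mulrA mul1r; lra.
Qed.

(** * The hypotheses on the levels in exponential form *)

Lemma expR_ln_nat (R : realType) (n : nat) : (2 <= n)%N ->
  expR (ln n%:R) = n%:R :> R.
Proof. by move=> n2; rewrite lnK// posrE ltr0n (leq_trans _ n2). Qed.

Lemma level_variance_expR (R : realType) (bp bt l : nat) (sp st : R) :
  (2 <= bp)%N -> (2 <= bt)%N ->
  bp%:R ^- l * Num.max (bp%:R `^ (- sp)) (bt%:R `^ (- st)) ^+ l =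
  expR (- (exponent_s bp bt sp st * l%:R)).
Proof.
move=> bp2 bt2; rewrite -(expR_ln_nat R bp2) -(expR_ln_nat R bt2) -!expRM.
have -> (u v : R) : Num.max (expR u) (expR v) = expR (Num.max u v).
  by rewrite /Num.max ltr_expR; case: ifP.
rewrite -exprVn -expRN -!expRM_natr -expRD; congr expR.
rewrite /exponent_s !mulrN -oppr_min (mulrC sp) (mulrC st); ring.
Qed.

Lemma level_work_expR (R : realType) (bp bt l : nat) (gp : R) :
  (2 <= bp)%N -> (2 <= bt)%N ->
  (bt ^ l)%N%:R * (bp ^ l)%N%:R `^ gp = expR (exponent_gamma bp bt gp * l%:R).
Proof.
move=> bp2 bt2; rewrite !natrX -{1}(expR_ln_nat R bp2) -{1}(expR_ln_nat R bt2).
rewrite -!expRM_natr -expRM -expRD /exponent_gamma; congr expR; ring.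
Qed.

Lemma level_bias_le (R : realType) (bp bt l : nat) :
  (2 <= bp)%N -> (2 <= bt)%N ->
  (bt ^ l)%N%:R^-1 + (bp ^ l)%N%:R^-1
  <= 2 * expR (- (exponent_w R bp bt * l%:R)).
Proof.
move=> bp2 bt2; rewrite !natrX -{1}(expR_ln_nat R bp2) -{1}(expR_ln_nat R bt2).
rewrite -!expRM_natr -!expRN mulrDl !mul1r.
by apply: lerD; rewrite ler_expR lerN2 ler_wpM2r// ge_min lexx ?orbT.
Qed.

(** * Moments of the multilevel estimator *)

Section mlmc_moments.
Context (dO dE : measure_display) (Omega : measurableType dO) (R : realType)
  (Pr : probability Omega R) (E : measurableType dE) (bp : nat).
Variables (D : forall l : nat, (bp ^ l)%N.-tuple E -> R)
  (W : forall i : nat * nat, Omega -> (bp ^ i.1)%N.-tuple E).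
Variables (mu v : nat -> R) (L : nat) (M : nat -> nat).
Hypothesis mD : forall l, measurable_fun setT (@D l).
Hypothesis mW : forall i, measurable_fun setT (W i).
Hypothesis indW : mutually_independent Pr W.
Hypothesis ED : forall i, ('E_Pr[@D i.1 \o W i] = (mu i.1)%:E)%E.
Hypothesis VD : forall i, ('V_Pr[@D i.1 \o W i] = (v i.1)%:E)%E.
Hypothesis M0 : forall l, (0 < M l)%N.

Let Y (i : nat * nat) : Omega -> R := (M i.1)%:R^-1 \o* (@D i.1 \o W i).
Let r := [seq (l, m) | l <- iota 0 L.+1, m <- iota 0 (M l)].

Let D2 i : @D i.1 \o W i \in Lfun Pr 2%:E.
Proof.
apply: Lfun2_of_variance; first exact: (measurableT_comp (@mD _) (@mW _)).
by rewrite VD ltry.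
Qed.

Let Y2 i : Y i \in Lfun Pr 2%:E.
Proof. by rewrite Lfun_scale ?ler1n. Qed.

(** The double sum over levels and samples becomes a sum over the pairs of
indices, to which the formula for uncorrelated variables applies. *)
Let estimatorE : mlmc_estimator D W L M = (\sum_(i <- r) Y i)%R.
Proof.
apply/funext => x; rewrite fct_sumE /r big_allpairs_dep.
rewrite -[iota 0 L.+1]/(index_iota 0 L.+1) big_mkord.
apply: eq_bigr => l _.
rewrite -[iota 0 (M l)](_ : index_iota 0 (M l) = _); last first.
  by rewrite /index_iota subn0.
by rewrite big_mkord mulr_sumr; apply: eq_bigr => m _; rewrite /Y /= mulrC.
Qed.

Let uncorrelated (i j : nat * nat) : i != j -> covariance Pr (Y i) (Y j) = 0%E.
Proof.
move=> ij; apply: covariance_independent => // A B mA mB.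
have mg (k : nat * nat) : measurable_fun setT ((M k.1)%:R^-1 \o* @D k.1).
  exact: (measurable_funM (@mD _) (measurable_cst _)).
have mU (k : nat * nat) (U : set R) : measurable U ->
    measurable (((M k.1)%:R^-1 \o* @D k.1) @^-1` U).
  by move=> mU; rewrite -[X in measurable X]setTI; exact: mg.
exact: (mutually_independent2 indW ij (mU i A mA) (mU j B mB)).
Qed.

Let uniq_r : uniq r.
Proof.
apply: allpairs_uniq_dep => [|l _|[l m] [l' m'] _ _ /= [-> ->]//];
  exact: iota_uniq.
Qed.

(** The [M l] samples of a level share the weight [1 / M l]. *)
Let sum_r (f : nat -> R) :
  \sum_(i <- r) (M i.1)%:R^-1 * f i.1 = \sum_(l < L.+1) f l.
Proof.
rewrite /r big_allpairs_dep -[iota 0 L.+1]/(index_iota 0 L.+1) big_mkord.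
apply: eq_bigr => l _ /=.
rewrite big_const_seq count_predT size_iota iter_addr_0 -[LHS]mulr_natl.
by rewrite mulVKf// pnatr_eq0 -lt0n.
Qed.

Lemma mlmc_estimator_Lfun2 : mlmc_estimator D W L M \in Lfun Pr 2%:E.
Proof.
rewrite estimatorE.
by have [] := variance_sum_uncorrelated uniq_r (fun i _ => Y2 i) uncorrelated.
Qed.

Lemma mlmc_estimator_mean :
  ('E_Pr[mlmc_estimator D W L M] = (\sum_(l < L.+1) mu l)%:E)%E.
Proof.
have Pfin : Pr setT \is a fin_num := fin_num_measure Pr _ measurableT.
rewrite estimatorE -(big_map Y xpredT id) expectation_sum => [|Z /mapP[i _ ->]].
  rewrite big_map -sum_r -sumEFin; apply: eq_bigr => i _.
  by rewrite expectationZl ?ED// Lfun_subset12.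
exact: Lfun_subset12.
Qed.

Lemma mlmc_estimator_variance :
  ('V_Pr[mlmc_estimator D W L M] = (\sum_(l < L.+1) (M l)%:R^-1 * v l)%:E)%E.
Proof.
rewrite estimatorE.
have [_ ->] := variance_sum_uncorrelated uniq_r (fun i _ => Y2 i) uncorrelated.
rewrite -(sum_r (fun l => (M l)%:R^-1 * v l)) -sumEFin.
apply: eq_bigr => i _; rewrite varianceZ// VD -EFinM.
by rewrite expr2 mulrA.
Qed.

End mlmc_moments.

(** By the triangle inequality an error of at least [tol] with a bias of at
most [tol / 2] leaves a deviation of at least [tol / 2] from the mean. *)
Lemma chebyshev_bias (d : measure_display) (T : measurableType d)
    (R : realType) (P : probability T R) (A : T -> R) (a mu v eps tol : R) :
  A \in Lfun P 2%:E -> ('E_P[A] = mu%:E)%E -> ('V_P[A] = v%:E)%E ->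
  0 < tol -> `|mu - a| <= tol / 2 -> v <= eps * (tol / 2) ^+ 2 ->
  (P [set x | (tol <= `|A x - a|)%R] <= eps%:E)%E.
Proof.
move=> A2 EA VA tol0 bias var.
have /andP[/[!inE]/= mA _] := A2.
pose A' : {RV P >-> R} := HB.pack A (isMeasurableFun.Build _ _ _ _ _ mA).
have t20 : 0 < tol / 2 by rewrite divr_gt0.
have mS (b c : R) : measurable [set x | (c <= `|A x - b|)%R].
  rewrite -[X in measurable X]setTI.
  rewrite [X in _ `&` X](_ : _ = (fun x => `|A x - b|) @^-1` `[c, +oo[%classic).
    apply: (measurableT_comp (@normr_measurable R setT) _) => //.
    exact: measurable_funB.
  by apply/seteqP; split=> x; rewrite /= in_itv/= andbT.
apply: (@le_trans _ _ (P [set x | (tol / 2 <= `|A x - mu|)%R])).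
  apply: le_measure; rewrite ?inE// => x /= h.
  by have := ler_distD mu (A x) a; lra.
have := chebyshev A' t20; rewrite [fine _](_ : _ = mu); last by rewrite EA.
move/le_trans; apply; rewrite [X in (_ * X)%E]VA -EFinM lee_fin.
by rewrite mulrC ler_pdivrMr ?exprn_gt0.
Qed.

(** * Complexity *)

(** Here [s = 2 ln b], [gamma = 3 ln b] and [w = ln b]: the work dominates and
[(gamma - s) / w = 1]. *)
Lemma mlmc_rate_example (R : realType) (b : nat) (tol : R) : (2 <= b)%N ->
  0 < tol ->
  mlmc_rate (exponent_s b b 1 2) (exponent_gamma b b 2) (exponent_w R b b) tol
  = tol ^- 3.
Proof.
move=> b2 tol0; have lb0 : 0 < ln b%:R :> R by rewrite ln_gt0// ltr1n.
have sE : exponent_s b b 1 2 = 2 * ln b%:R :> R.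
  by rewrite /exponent_s min_l; [ring|rewrite ler_pM2r// ler1n].
have gE : exponent_gamma b b 2 = 3 * ln b%:R :> R.
  by rewrite /exponent_gamma; ring.
rewrite sE gE /exponent_w minxx /mlmc_rate.
rewrite ifF; last by apply/negbTE; rewrite -leNgt ler_pM2r// ler_nat.
rewrite ifF; last by rewrite lt_eqF// ltr_pM2r// ltr_nat.
rewrite -powR_invn ?ltW//; congr (_ `^ _).
by field; rewrite gt_eqF.
Qed.

Theorem mainTheorem5 (R : realType)
  (dO dE dS : measure_display)
  (Omega : measurableType dO) (Pr : probability Omega R)
  (E : measurableType dE) (S : measurableType dS)
  (phi_inf gp sp st eps : R) (bp bt : nat)
  (om : nat -> Omega -> E)
  (psi : S -> R) (X : forall P N n : nat, P.-tuple E -> P.-tuple S)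
  (varphi : forall l : nat, (bp ^ l)%N.-tuple E -> R)
  (work : nat -> R)
  (W : forall i : nat * nat, Omega -> (bp ^ i.1)%N.-tuple E) :
  let phi := particle_average psi X in
  let D := level_difference bt phi varphi in
  let s := exponent_s bp bt sp st in
  let gamma := exponent_gamma bp bt gp in
  let w := exponent_w R bp bt in
  1 <= gp -> 0 <= sp -> 0 < st -> (2 <= bp)%N -> (2 <= bt)%N ->
  s <= 2 * w ->
  0 < eps < 1 ->
  (* i.i.d. inputs of the particles (om p is omega_(p+1)) *)
  (forall p, measurable_fun setT (om p)) ->
  mutually_independent Pr om ->
  (forall p, same_distribution Pr (om p) (om 0%N)) ->
  (* quantity of interest, particle system *)
  measurable_fun setT psi ->
  (forall P N n, (0 < P)%N -> (0 < N)%N -> (n <= N)%N ->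
    measurable_fun setT (X P N n)) ->
  (forall P N, (0 < P)%N -> (0 < N)%N ->
    exchangeable Pr (X P N N \o inputs om P)) ->
  (* coarse couplings *)
  (forall l, measurable_fun setT (varphi l)) ->
  (forall v, varphi 0%N v = 0) ->
  (forall l, 'E_Pr[varphi l.+1 \o inputs om (bp ^ l.+1)%N] =
             'E_Pr[phi (bp ^ l)%N (bt ^ l)%N \o inputs om (bp ^ l)%N])%E ->
  (* independent samples of the inputs *)
  (forall i, measurable_fun setT (W i)) ->
  (forall i, same_distribution Pr (W i) (inputs om (bp ^ i.1)%N)) ->
  mutually_independent Pr W ->
  (* bias, variance and work rates; a finite variance of a measurable function
     forces square integrability, so the latter is not assumed separately *)
  (exists C : R, forall P N, (0 < P)%N -> (0 < N)%N ->
    (`| 'E_Pr[phi P N \o inputs om P] - phi_inf%:E |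
       < (C * (N%:R^-1 + P%:R^-1))%:E)%E) ->
  (exists C : R, forall P N, (0 < P)%N -> (0 < N)%N ->
    ('V_Pr[phi P N \o inputs om P] < (C * P%:R^-1)%:E)%E) ->
  (exists C : R, forall l,
    ('V_Pr[D l \o inputs om (bp ^ l)%N]
       < (C * (bp%:R ^- l *
               Num.max (bp%:R `^ (- sp)) (bt%:R `^ (- st)) ^+ l))%:E)%E) ->
  (exists C : R, forall l,
    work l < C * ((bt ^ l)%N%:R * (bp ^ l)%N%:R `^ gp)) ->
  exists c : R, forall TOL : R, 0 < TOL < expR (- 1) ->
  exists (L : nat) (M : nat -> nat),
    [/\ (forall l, (l <= L)%N -> (0 < M l)%N),
        (Pr [set x | (TOL <= `| mlmc_estimator D W L M x - phi_inf |)%R]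
           <= eps%:E)%E,
        mlmc_work work L M < c * mlmc_rate s gamma w TOL &
        bp = bt -> gp = 2 -> sp = 1 -> st = 2 ->
          mlmc_work work L M < c * TOL ^- 3].
Proof.
move=> phi D s gamma w gp1 sp0 st0 bp2 bt2 sw /andP[eps0 _] mom _ _ mpsi mX _
  mvarphi varphi0 Evarphi mW dW indW [Cb Hb] [Cv Hv] [Cd Hd] [Cw Hw].
have lbp0 : 0 < ln bp%:R :> R by rewrite ln_gt0// ltr1n.
have lbt0 : 0 < ln bt%:R :> R by rewrite ln_gt0// ltr1n.
have w0 : 0 < w by rewrite lt_min lbp0.
have gamma0 : 0 < gamma.
  by rewrite addr_gt0// mulr_gt0// (lt_le_trans ltr01).
pose C := Num.max 1 (Num.max Cb (Num.max Cd Cw)).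
have C1 : 1 <= C by rewrite le_max lexx.
have CbC : Cb <= C by rewrite !le_max lexx !orbT.
have CdC : Cd <= C by rewrite !le_max lexx !orbT.
have CwC : Cw <= C by rewrite !le_max lexx !orbT.
have [c Hc] := mlmc_parameters C1 w0 gamma0 sw eps0.
exists c => tol tolP; have [L [M [M0 hbias hvar hwork]]] := Hc tol tolP.
have /andP[tol0 _] := tolP.
have bpX l : (0 < bp ^ l)%N by rewrite expn_gt0 (ltn_trans _ bp2).
have btX l : (0 < bt ^ l)%N by rewrite expn_gt0 (ltn_trans _ bt2).
have workC : mlmc_work work L M < c * mlmc_rate s gamma w tol.
  apply: le_lt_trans hwork; apply: ler_sum => l _.
  rewrite ler_wpM2l// (le_trans (ltW (Hw l)))// level_work_expR//.
  by rewrite ler_wpM2r ?expR_ge0.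
exists L, M; split => //; last first.
  move=> ebt gpE spE stE.
  by move: workC; rewrite /s /gamma /w gpE spE stE -ebt mlmc_rate_example.
pose om_ l := inputs om (bp ^ l)%N.
have mom_ l : measurable_fun setT (om_ l).
  apply/measurable_fun_tnthP => i.
  rewrite (_ : _ \o _ = om i); first exact: mom.
  by apply/funext => x; rewrite /= /om_ /inputs tnth_mktuple.
have mphi l : measurable_fun setT (phi (bp ^ l)%N (bt ^ l)%N).
  apply: measurable_funM; first exact: measurable_cst.
  apply: measurable_sum => p; apply: (measurableT_comp mpsi).
  by apply: (measurableT_comp (measurable_tnth p)); exact: mX.
have mD l : measurable_fun setT (@D l).
  exact: (measurable_funB (@mphi l) (@mvarphi l)).
(* The bounds on the variances make the particle approximations and the level
   differences, hence also the coarse couplings, square integrable. *)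
have phi2 l : phi (bp ^ l)%N (bt ^ l)%N \o om_ l \in Lfun Pr 2%:E.
  apply: Lfun2_of_variance; first exact: (measurableT_comp (@mphi l) (@mom_ l)).
  by rewrite (lt_trans (Hv _ _ (bpX l) (btX l)))// ltry.
have D2 l : @D l \o om_ l \in Lfun Pr 2%:E.
  apply: Lfun2_of_variance; first exact: (measurableT_comp (@mD l) (@mom_ l)).
  by rewrite (lt_trans (Hd l))// ltry.
have Pfin : Pr setT \is a fin_num := fin_num_measure Pr _ measurableT.
pose mu l := fine 'E_Pr[@D l \o om_ l].
pose v l := fine 'V_Pr[@D l \o om_ l].
pose e l := fine 'E_Pr[phi (bp ^ l)%N (bt ^ l)%N \o om_ l].
have Ephi l : ('E_Pr[phi (bp ^ l)%N (bt ^ l)%N \o om_ l] = (e l)%:E)%E.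
  by rewrite fineK// expectation_fin_num// Lfun_subset12.
have ED (i : nat * nat) : ('E_Pr[@D i.1 \o W i] = (mu i.1)%:E)%E.
  rewrite (expectation_same_distribution (@mW i) (@mom_ i.1) (dW i) (@mD i.1)).
  by rewrite fineK// expectation_fin_num// Lfun_subset12.
have VD (i : nat * nat) : ('V_Pr[@D i.1 \o W i] = (v i.1)%:E)%E.
  rewrite (variance_same_distribution (@mW i) (@mom_ i.1) (dW i) (@mD i.1)).
  by rewrite fineK// variance_fin_num.
(* The means of the level differences telescope, because the coarse coupling
   on level [l + 1] has the mean of the particle approximation on level [l]. *)
have mu0 : mu 0%N = e 0%N.
  rewrite /mu /e; congr (fine 'E_Pr[_]); apply/funext => x /=.
  by rewrite /D /level_difference varphi0 subr0.
have muS l : mu l.+1 = e l.+1 - e l.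
  have -> : mu l.+1 = fine ('E_Pr[phi (bp ^ l.+1)%N (bt ^ l.+1)%N \o om_ l.+1]
      - 'E_Pr[@varphi l.+1 \o om_ l.+1])%E.
    rewrite -expectationB//; first exact: Lfun_subset12.
    rewrite (_ : _ \o _ = (phi (bp ^ l.+1)%N (bt ^ l.+1)%N \o om_ l.+1)
      \- (@D l.+1 \o om_ l.+1)).
      by rewrite rpredB// ?lee1n//= ?Lfun_subset12.
    by apply/funext => x /=; rewrite /D /level_difference subKr.
  by rewrite Evarphi !Ephi.
have sum_mu n : \sum_(l < n.+1) mu l = e n.
  elim: n => [|n IH]; first by rewrite big_ord1.
  by rewrite big_ord_recr /= IH muS addrC subrK.
have A2 : mlmc_estimator D W L M \in Lfun Pr 2%:E.
  exact: (mlmc_estimator_Lfun2 (v := v)).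
have EA : ('E_Pr[mlmc_estimator D W L M] = (e L)%:E)%E.
  by rewrite -sum_mu; exact: (mlmc_estimator_mean (v := v)).
have VA : ('V_Pr[mlmc_estimator D W L M] =
    (\sum_(l < L.+1) (M l)%:R^-1 * v l)%:E)%E.
  exact: mlmc_estimator_variance.
apply: (chebyshev_bias A2 EA VA tol0).
- have := Hb _ _ (bpX L) (btX L); rewrite Ephi -EFinB lte_fin => /ltW.
  move=> /le_trans; apply; apply: le_trans hbias.
  rewrite -mulrA mulrCA; apply: le_trans (ler_wpM2r _ CbC) _.
    by rewrite addr_ge0// invr_ge0.
  by rewrite ler_wpM2l ?(le_trans _ C1)// level_bias_le.
- apply: le_trans hvar; apply: ler_sum => l _; rewrite ler_wpM2l ?invr_ge0//.
  have := Hd l; rewrite -[in X in (X < _)%E](fineK (variance_fin_num (D2 l))).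
  rewrite lte_fin level_variance_expR// => /ltW /le_trans; apply.
  by rewrite ler_wpM2r ?expR_ge0.
Qed.
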